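(* Let $n\ge 1$ and let $f: X \rightarrow Y$ be an ls-continuous map between ls-spaces. If $f$ is coarsely $n$-to-$1$, then it is coarsely light.
   Context: For families $\mathcal{B},\mathcal{U}$ of subsets of a set $X$, $\mathrm{st}(B,\mathcal{U})$ is the union of the elements of $\mathcal{U}$ that intersect $B\subseteq X$, and $\mathrm{st}(\mathcal{B},\mathcal{U})=\{\mathrm{st}(B,\mathcal{U})\mid B\in\mathcal{B}\}$. A large scale structure (ls-structure) on $X$ is a nonempty set $\mathcal{L}$ of families of subsets of $X$ (the uniformly bounded families) such that (1) if $\mathcal{B}_1\in\mathcal{L}$ and each element of $\mathcal{B}_2$ with more than one point is contained in an element of $\mathcal{B}_1$, then $\mathcal{B}_2\in\mathcal{L}$; (2) $\mathcal{B}_1,\mathcal{B}_2\in\mathcal{L}$ implies $\mathrm{st}(\mathcal{B}_1,\mathcal{B}_2)\in\mathcal{L}$. An ls-space is a set with an ls-structure. A map $f:X\to Y$ of ls-spaces is ls-continuous if $f(\mathcal{U})=\{f(U)\mid U\in\mathcal{U}\}$ is uniformly bounded for every uniformly bounded $\mathcal{U}$. An ls-continuous map $f:X\to Y$ is coarsely $n$-to-$1$ if for every uniformly bounded cover $\mathcal{V}$ of $Y$ there is a uniformly bounded cover $\mathcal{U}$ of $X$ such that each set $f^{-1}(V)$, $V\in\mathcal{V}$, is contained in the union of $n$ elements of $\mathcal{U}$. For a family $\mathcal{U}$ of subsets of $X$ and $A\subseteq X$, the $\mathcal{U}$-components of $A$ are the equivalence classes of the relation on $A$: $x,x'$ are joined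 by a finite sequence $x=x_1,\dots,x_k=x'$ in $A$ with each pair $x_i,x_{i+1}$ in a common element of $\mathcal{U}$. For uniformly bounded $\mathcal{U}$ in $X$, $\mathcal{V}$ in $Y$, $c(\mathcal{U},f,\mathcal{V})$ is the family of all $\mathcal{U}$-components of sets $f^{-1}(V)$, $V\in\mathcal{V}$. The light structure on $X$ with respect to $f$ is the closure under refinement of the set of all $c(\mathcal{U},f,\mathcal{V})$ (all families each of whose elements with more than one point is contained in an element of one fixed $c(\mathcal{U},f,\mathcal{V})$). The map $f$ is coarsely light if the light structure with respect to $f$ equals the ls-structure of $X$. *)

(* Defs.v *)
From mathcomp Require Import all_boot boolp classical_sets.

Set Implicit Arguments.
Unset Strict Implicit.
Unset Printing Implicit Defensive.

Local Open Scope classical_set_scope.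

Section Families.
Variable X : Type.
Implicit Types (A B : set X) (F G U : set (set X)).

Definition star B U : set X := \bigcup_(A in [set A | U A /\ A `&` B !=set0]) A.

Definition star_family F U : set (set X) := [set star B U | B in F].

Definition many_points A : Prop := exists x y, [/\ A x, A y & x <> y].

(* Elements of F with at most one point are unconstrained. *)
Definition refines F G : Prop :=
  forall B, F B -> many_points B -> exists2 A, G A & B `<=` A.

Definition covers U : Prop := \bigcup_(A in U) A = setT.

(* The sequence is c 0, ..., c k; taking k = 0 makes every point of A
   joined to itself, whether or not U covers it. *)
Definition joined U A (x x' : X) : Prop :=
  exists (k : nat) (c : nat -> X),
    [/\ c 0 = x, c k = x',
        forall i, i <= k -> A (c i) &
        forall i, i < k -> exists2 W, U W & W (c i) /\ W (c i.+1)].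

Definition components U A : set (set X) :=
  [set [set x' | joined U A x x'] | x in A].

End Families.

Record lsSpace := LsSpace {
  ls_sort :> Type;
  unif_bounded : set (set (set ls_sort));
  unif_bounded_nonempty : unif_bounded !=set0;
  unif_bounded_refines : forall B1 B2,
    unif_bounded B1 -> refines B2 B1 -> unif_bounded B2;
  unif_bounded_star : forall B1 B2,
    unif_bounded B1 -> unif_bounded B2 -> unif_bounded (star_family B1 B2)
}.

Section Maps.
Variables X Y : lsSpace.
Implicit Types (f : X -> Y) (U : set (set X)) (V : set (set Y)).

Definition ls_continuous f : Prop :=
  forall U, unif_bounded U -> unif_bounded [set f @` A | A in U].

(* The n elements of U are not required to be distinct. *)
Definition coarsely_n_to_1 (n : nat) f : Prop :=
  forall V, unif_bounded V -> covers V ->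
    exists U, [/\ unif_bounded U, covers U &
      forall B, V B -> exists W : 'I_n -> set X,
        (forall i, U (W i)) /\ f @^-1` B `<=` \bigcup_i W i].

Definition component_family U f V : set (set X) :=
  \bigcup_(B in V) components U (f @^-1` B).

Definition light_structure f : set (set (set X)) :=
  [set F | exists U V, [/\ unif_bounded U, unif_bounded V &
                           refines F (component_family U f V)]].

Definition coarsely_light f : Prop :=
  light_structure f = @unif_bounded X.

End Maps.

(* Main.v *)
Require Import Defs.
From mathcomp Require Import all_boot boolp classical_sets.

(** If [f^-1(B)] is contained in [W_1 `|` ... `|` W_n], put a graph on the
    indices by joining [i] to [j] when some element of [U] meets both [W_i] and
    [W_j].  A [U]-chain inside [f^-1(B)] is tracked by a walk in this graph, and
    a walk may be shortened to a simple path, of length less than [n].  Hence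
    every [U]-component of [f^-1(B)] lies in an [n]-fold iterated star of a
    single [W_i], whatever the length of the chains. *)

Local Open Scope classical_set_scope.

Section Stars.
Set Implicit Arguments.
Unset Strict Implicit.
Variable X : Type.
Implicit Types (A B S : set X) (F U : set (set X)).

Lemma sub_star U A B : U A -> A `&` B !=set0 -> A `<=` star B U.
Proof. by move=> UA AB x Ax; exists A. Qed.

Lemma star_refl U B : covers U -> B `<=` star B U.
Proof.
move=> cU x Bx; have [A UA Ax] : (\bigcup_(A in U) A) x by rewrite cU.
by apply: (@sub_star U A B UA _ x Ax); exists x.
Qed.

(** The cost of one edge of the walk: the star in [U] reaches a point of the neighbouring set, and
    the star in [W], a family containing that set, then absorbs all of it. *)
Definition star2 U W S := star (star S U) W.

Definition star2_family U W F := star_family (star_family F U) W.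

Lemma iter_star2_family U W F S m : F S ->
  iter m (star2_family U W) F (iter m (star2 U W) S).
Proof.
move=> FS; elim: m => //= m IH.
by exists (star (iter m (star2 U W) S) U) => //; exists (iter m (star2 U W) S).
Qed.

Lemma sub_iter_star2 U W S m k : covers U -> covers W -> m <= k ->
  iter m (star2 U W) S `<=` iter k (star2 U W) S.
Proof.
move=> cU cW /subnK <-; elim: (k - m) => [//|d IH] x /IH Sx.
by rewrite addSn; apply: star_refl => //; apply: star_refl.
Qed.

Definition linked U n (W : 'I_n -> set X) : rel 'I_n := fun i j =>
  `[< exists y z, [/\ W i y, W j z & exists2 A, U A & A y /\ A z] >].

Lemma linked_path_sub U F n (W : 'I_n -> set X) (FW : forall i, F (W i)) i p S :
  W i `<=` S -> path (linked U W) i p ->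
  W (last i p) `<=` iter (size p) (star2 U F) S.
Proof.
elim: p i S => [//|j p IH] i S WS /= /andP[/asboolP[y [z [Wy Wz [A UA [Ay Az]]]]] ij].
(* The first edge is absorbed into the starting set: the induction hypothesis is applied to
   [star2 U F S], which contains [W j]. *)
rewrite -iterS iterSr; apply: (IH j) => //.
apply: sub_star => //; exists z; split=> //.
by apply: (sub_star UA) Az; exists y; split=> //; apply: WS.
Qed.

Lemma linked_connect_sub U F n (W : 'I_n -> set X) (FW : forall i, F (W i)) i j :
  covers U -> covers F -> connect (linked U W) i j ->
  W j `<=` iter n (star2 U F) (W i).
Proof.
move=> cU cF /connectP[p0 pth ->]; case/shortenP: pth => p pth up _ x Wx.
(* The [size p + 1] vertices of a simple path are distinct elements of ['I_n]. *)
have le_pn : size p <= n.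
  have := uniq_leq_size up (fun k _ => mem_enum 'I_n k).
  by rewrite size_enum_ord /= => /ltnW.
apply: sub_iter_star2 cU cF le_pn _ _.
exact: (linked_path_sub FW (@subset_refl _ (W i)) pth Wx).
Qed.

Lemma joined_linked U A n (W : 'I_n -> set X) i x x' :
  A `<=` \bigcup_i W i -> W i x -> joined U A x x' ->
  exists2 j, connect (linked U W) i j & W j x'.
Proof.
move=> AW Wx [k [c [c0 <- cA cU]]].
(* Induction over the prefixes [c 0, ..., c m] with [m <= k]; the chain itself stays fixed. *)
elim: {-2}k (leqnn k) => [_|m IH mk]; first by exists i; rewrite ?connect0 ?c0.
have [j ij Wj] := IH (ltnW mk); have [l _ Wl] := AW _ (cA _ mk).
exists l => //; apply: connect_trans ij (connect1 _); apply/asboolP.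
by exists (c m), (c m.+1); split=> //; apply: cU.
Qed.

Lemma joined_mono U U' A x x' : U `<=` U' -> joined U A x x' -> joined U' A x x'.
Proof.
move=> UU' [k [c [c0 ck cA cU]]]; exists k, c; split=> // i /cU[W UW ?].
by exists W => //; apply: UU'.
Qed.

Lemma sub_component F A B x : F B -> B `<=` A -> B x ->
  B `<=` [set x' | joined F A x x'].
Proof.
move=> FB BA Bx y By.
exists 1, (fun i => if i is 0 then x else y); split=> //.
  by case=> [|i] _; apply: BA.
by case=> [|//] _; exists B.
Qed.

(** Refinement ignores singletons, so adding them turns any uniformly bounded family into a
    uniformly bounded cover. *)
Definition add_points F := F `|` range set1.

Lemma covers_add_points F : covers (add_points F).
Proof. by apply/seteqP; split=> // x _; exists [set x] => //; right; exists x. Qed.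

Lemma refines_add_points F : refines (add_points F) F.
Proof.
move=> B [FB _|[x _ <-] [y [z [-> ->]]] //]; by exists B.
Qed.

End Stars.

Section LightStructure.
Set Implicit Arguments.
Unset Strict Implicit.
Variables X Y : lsSpace.
Implicit Types (f : X -> Y) (U : set (set X)) (V : set (set Y)).

Lemma unif_bounded_add_points (Z : lsSpace) (F : set (set Z)) :
  unif_bounded F -> unif_bounded (add_points F).
Proof. by move=> bF; apply: unif_bounded_refines bF (@refines_add_points _ _). Qed.

Lemma unif_bounded_iter_star2 U W (F : set (set X)) m :
  unif_bounded U -> unif_bounded W -> unif_bounded F ->
  unif_bounded (iter m (star2_family U W) F).
Proof.
move=> bU bW bF; elim: m => //= m IH.
by do 2![apply: unif_bounded_star => //].
Qed.

(** Each [B] in [F] lies in the preimage of its own image, and any two of its points are joined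
    there in a single step, through [B] itself. *)
Lemma unif_bounded_light f F :
  ls_continuous f -> unif_bounded F -> light_structure f F.
Proof.
move=> cf bF; exists F, [set f @` A | A in F]; split=> //; first exact: cf.
move=> B FB [x [_ [Bx _ _]]].
have BfB : B `<=` f @^-1` (f @` B) by move=> y By; exists y.
exists [set x' | joined F (f @^-1` (f @` B)) x x'].
  by exists (f @` B); [exists B|exists x => //; apply: BfB].
exact: sub_component.
Qed.

Lemma unif_bounded_component_family n f U V : coarsely_n_to_1 n f ->
  unif_bounded U -> unif_bounded V -> unif_bounded (component_family U f V).
Proof.
move=> fn bU bV.
have [F [bF cF VF]] := fn _ (unif_bounded_add_points bV) (covers_add_points _).
have bU' := unif_bounded_add_points bU.
(* The number of stars depends on [n] alone, so one uniformly bounded family serves all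
   components. *)
apply: unif_bounded_refines (unif_bounded_iter_star2 n bU' bF bF) _.
move=> _ [B VB [x Bx <-]] _.
have [W [FW BW]] := VF B (or_introl VB); have [i _ Wx] := BW _ Bx.
exists (iter n (star2 (add_points U) F) (W i)).
  exact: iter_star2_family.
(* Chains for [U] are also chains for the cover [add_points U]. *)
move=> x' /(joined_mono (@subsetUl _ U (range set1))) xx'.
have [j ij Wj] := joined_linked BW Wx xx'.
exact: (linked_connect_sub FW (@covers_add_points _ U) cF ij Wj).
Qed.

End LightStructure.

Theorem proposition3p7 (X Y : lsSpace) (n : nat) (hn : 1 <= n) (f : X -> Y)
  (hf : ls_continuous f) (hn1 : coarsely_n_to_1 n f) : coarsely_light f.
Proof.
apply/seteqP; split=> F; last exact: unif_bounded_light.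
move=> [U [V [bU bV]]]; apply: unif_bounded_refines.
exact: unif_bounded_component_family hn1 bU bV.
Qed.
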